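(* Let $w \ge 1$ be an integer and $J_m = (2^m-(-1)^m)/3$. For every integer $N$ with $J_w < N \le J_{w+1}$ we have $a(N) = w$.
   Context: Setting (alternator coin problem): There are $N$ identical-looking coins. All but one are real and have the same weight. The remaining coin, the alternator, behaves as follows: each time it is placed on a balance scale it weighs either the same as a real coin (''acts real'') or strictly less than a real coin (''acts fake''), and it switches between these two behaviours every time it is on the scale; while off the scale its behaviour does not change. A weighing places two disjoint sets of coins with the same number of coins on the two pans, and its outcome is one of: the pans balance, the left pan is lighter, or the right pan is lighter. Weighings may be chosen adaptively based on earlier outcomes. A strategy finds the alternator if, for every possible identity of the alternator and every possible starting behaviour, the outcomes determine which coin it is. $a(N)$ is the smallest number of weighings that guarantees finding the alternator among $N$ coins when it is not known whether its first appearance on the scale will be as a real or as a fake coin. $J_m=(2^m-(-1)^m)/3$ is the $m$-th Jacobsthal number ($J_0=0,J_1=1,J_2=1,J_3=3,J_4=5,\dots$). *)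

(* Defs.v *)
From mathcomp Require Import all_boot all_order all_algebra.
Set Implicit Arguments.
Unset Strict Implicit.
Unset Printing Implicit Defensive.

Definition jacobsthal (m : nat) : rat := ((2 ^+ m - (-1) ^+ m) / 3)%R.

Record weighing (N : nat) := Weighing {
  left_pan : {set 'I_N};
  right_pan : {set 'I_N};
  pans_disjoint : [disjoint left_pan & right_pan];
  pans_same_size : #|left_pan| = #|right_pan|
}.

Inductive outcome := Balance | LeftLighter | RightLighter.

(* [fake] tells how the alternator [alt] acts the next time it is weighed.
   As the pans hold equally many coins, only [alt] acting fake tips them. *)
Definition weigh (N : nat) (p : weighing N) (alt : 'I_N) (fake : bool) :
    outcome :=
  if fake && (alt \in left_pan p) then LeftLighter
  else if fake && (alt \in right_pan p) then RightLighter
  else Balance.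

Definition next_fake (N : nat) (p : weighing N) (alt : 'I_N) (fake : bool) :
    bool :=
  if alt \in left_pan p :|: right_pan p then ~~ fake else fake.

Inductive strategy (N : nat) :=
  | Stop
  | Weigh (p : weighing N) (next : outcome -> strategy N).
Arguments Stop {N}.

Fixpoint outcomes (N : nat) (s : strategy N) (alt : 'I_N) (fake : bool) :
    seq outcome :=
  match s with
  | Stop => [::]
  | Weigh p next =>
      let o := weigh p alt fake in
      o :: outcomes (next o) alt (next_fake p alt fake)
  end.

Definition finds_alternator (N : nat) (s : strategy N) : Prop :=
  forall (alt1 alt2 : 'I_N) (fake1 fake2 : bool),
    outcomes s alt1 fake1 = outcomes s alt2 fake2 -> alt1 = alt2.

Definition uses_at_most (N : nat) (s : strategy N) (w : nat) : Prop :=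
  forall (alt : 'I_N) (fake : bool), size (outcomes s alt fake) <= w.

Definition can_find_within (N w : nat) : Prop :=
  exists s : strategy N, finds_alternator s /\ uses_at_most s w.

(* [is_a N w] says that a(N) = w: the least number of weighings is w. *)
Definition is_a (N w : nat) : Prop :=
  can_find_within N w /\ forall v : nat, can_find_within N v -> w <= v.

(* Main.v *)
Require Import Defs.
From HB Require Import structures.
From mathcomp Require Import all_boot all_order all_algebra.
From mathcomp Require Import zify ring.
Set Implicit Arguments.
Unset Strict Implicit.
Unset Printing Implicit Defensive.

(** Follow the set of states (coin, next behaviour) compatible with the outcomes
    seen so far.  A tilt towards a pan leaves coins of that pan only, all acting
    real next, and if all states act real then the next weighing balances.

    Lower bound: let every coin have one starting behaviour.  A strategy with
    [w] weighings then separates at most [J_(w+2)] coins, because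
    [J_(w+2) = J_(w+1) + 2 J_w] bounds the coins left after a balance and after
    either tilt, and at most [J_(w+1)] coins if all of them start by acting real.

    Upper bound: as long as all weighings balance, a coin is unknown (never
    weighed), due to act fake (weighed once), or genuine.  An unknown coin
    yields two outcome sequences, unless it is never weighed at all, so [u]
    unknown coins and [f] coins due to act fake need [2u + f <= J_(w+2)], with
    [1] to spare if [u > 0].  This suffices when [u <= J_(w+1)]: if there are
    more than [2 J_w] of these coins, weigh [2 J_w] of them, the unknown ones
    first but sparing one; otherwise weigh them all, sparing one (unknown if
    possible) if their number is odd.  After a tilt, weigh the remaining coins
    against genuine ones, so that all of them become due to act fake. *)

Fixpoint jac (m : nat) : nat :=
  match m with
  | 0 => 0
  | 1 => 1
  | (m'.+1 as m1).+1 => jac m1 + 2 * jac m'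
  end.
Arguments jac : simpl never.

Lemma jacSS (m : nat) : jac m.+2 = jac m.+1 + 2 * jac m.
Proof. by []. Qed.

Lemma jacobsthalE (m : nat) : jacobsthal m = ((jac m)%:R)%R.
Proof.
suff [] : jacobsthal m = ((jac m)%:R)%R /\ jacobsthal m.+1 = ((jac m.+1)%:R)%R by [].
rewrite /jacobsthal; elim: m => [|m [IH0 IH1]]; first by split.
split=> //; rewrite jacSS GRing.natrD GRing.natrM -IH0 -IH1 !GRing.exprS.
by field.
Qed.

(* [J_(m+1) = 2 J_m + (-1)^m], without subtraction. *)
Lemma jacS (m : nat) : jac m.+1 + odd m = 2 * jac m + ~~ odd m.
Proof. by elim: m => // m IH; rewrite jacSS; lia. Qed.

Lemma leq_jac : {homo jac : m n / m <= n}.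
Proof.
apply: homo_leq => [//|? ? ?|[//|m]]; first exact: leq_trans.
by rewrite jacSS leq_addr.
Qed.

Lemma jac_gt0 (m : nat) : 0 < jac m.+1.
Proof. exact: (@leq_jac 1). Qed.

Lemma exists_subset_card (T : finType) (A : {set T}) (k : nat) :
  k <= #|A| -> exists2 B : {set T}, B \subset A & #|B| = k.
Proof.
rewrite -bin_gt0 -cards_draws card_gt0 => /set0Pn[B].
by rewrite inE => /andP[sBA /eqP cardB]; exists B.
Qed.

Definition outcome_eq_dec : comparable outcome.
Proof. by move=> o o'; rewrite /decidable; decide equality. Defined.
HB.instance Definition _ := hasDecEq.Build outcome (compareP outcome_eq_dec).

Section States.

Variable N : nat.

Implicit Types (p : weighing N) (o : outcome) (s : strategy N) (w : nat).

Definition state : Type := ('I_N * bool)%type.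

Implicit Types (S T : {set state}) (x y : state) (A U F P : {set 'I_N}).

Definition pans p : {set 'I_N} := left_pan p :|: right_pan p.

Lemma card_pans p : #|pans p| = 2 * #|left_pan p|.
Proof.
have := leq_card_setU (left_pan p) (right_pan p).
by rewrite pans_disjoint -pans_same_size addnn -mul2n => -[_ /eqP].
Qed.

Lemma exists_weighing_pans (k : nat) P :
  #|P| = 2 * k -> exists2 p, pans p = P & #|left_pan p| = k.
Proof.
move=> cardP; have [|A sAP cardA] := @exists_subset_card _ P k; first lia.
have dis : [disjoint A & P :\: A].
  by rewrite disjoint_sym; case/subsetDP: (subxx (P :\: A)).
have same_size : #|A| = #|P :\: A| by rewrite cardsDS //; lia.
exists (Weighing dis same_size) => //.
by rewrite /pans /= setDE setUIr setUCr setIT; apply/setUidPr.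
Qed.

Lemma exists_weighing_left A : 2 * #|A| <= N -> exists p, left_pan p = A.
Proof.
move=> leAN; have [|B sBA cardB] := @exists_subset_card _ (~: A) #|A|.
  by have := cardsC A; rewrite card_ord; lia.
have dis : [disjoint A & B] by rewrite disjoint_sym disjoints_subset.
by exists (Weighing dis (esym cardB)).
Qed.

Lemma exists_weighing_cards (a b k : nat) U F :
  [disjoint U & F] -> a <= #|U| -> b <= #|F| -> a + b = 2 * k ->
  exists p, [/\ #|left_pan p| = k, #|U :&: pans p| = a & #|F :&: pans p| = b].
Proof.
move=> disUF /exists_subset_card[A sAU cardA] /exists_subset_card[B sBF cardB] cardAB.
have disUB := disjointWr sBF disUF; have disAF := disjointWl sAU disUF.
have [|p pansE cardL] := @exists_weighing_pans k (A :|: B).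
  have [_] := leq_card_setU A B.
  by rewrite (disjointWl sAU disUB) cardA cardB cardAB => /eqP.
exists p; rewrite pansE; split=> //.
  by rewrite setIUr (setIidPr sAU) (disjoint_setI0 disUB) setU0.
by rewrite setIUr (setIidPr sBF) setIC (disjoint_setI0 disAF) set0U.
Qed.

Definition step p x : state := (x.1, next_fake p x.1 x.2).

Lemma step_inj p : injective (step p).
Proof.
by move=> [i f] [j g] [<-{j}]; rewrite /next_fake; case: ifP => _ => [/negb_inj|] ->.
Qed.

Definition posterior p o S : {set state} :=
  step p @: [set x in S | weigh p x.1 x.2 == o].

Lemma posteriorP p o S y :
  reflect (exists x, [/\ x \in S, weigh p x.1 x.2 = o & y = step p x])
    (y \in posterior p o S).
Proof.
apply: (iffP imsetP) => [[x] | [x [xS wx ->]]].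
  by rewrite inE => /andP[xS /eqP wx] ->; exists x.
by exists x; rewrite // inE xS wx /=.
Qed.

Lemma mem_posterior p S x : x \in S -> step p x \in posterior p (weigh p x.1 x.2) S.
Proof. by move=> xS; apply/posteriorP; exists x. Qed.

Lemma card_posteriors p S :
  #|S| = #|posterior p Balance S| + #|posterior p LeftLighter S|
         + #|posterior p RightLighter S|.
Proof.
rewrite !card_imset; try exact: step_inj.
rewrite -!sum1dep_card -sum1_card !big_mkcondr -!big_split /=.
by apply: eq_bigr => x _; case: weigh.
Qed.

Lemma posterior_inj_fst p o S :
  {in S &, injective fst} -> {in posterior p o S &, injective fst}.
Proof.
move=> injS _ _ /posteriorP[x [xS _ ->]] /posteriorP[y [yS _ ->]] /= eq_coin.
by rewrite (injS x y).
Qed.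

Definition due_real A : {set state} := setX A [set false].

Lemma due_real_subT A : due_real A \subset due_real setT.
Proof. by rewrite setXS ?subsetT. Qed.

Lemma posterior_LeftLighter p S :
  posterior p LeftLighter S \subset due_real (left_pan p).
Proof.
apply/subsetP=> _ /posteriorP[[i f] [_ + ->]]; rewrite /weigh /step /next_fake !inE /=.
by case: f; case: (i \in left_pan p); case: (i \in right_pan p).
Qed.

Lemma posterior_RightLighter p S :
  posterior p RightLighter S \subset due_real (right_pan p).
Proof.
apply/subsetP=> _ /posteriorP[[i f] [_ + ->]]; rewrite /weigh /step /next_fake !inE /=.
by case: f; case: (i \in left_pan p); case: (i \in right_pan p).
Qed.

Lemma posterior_due_real p o S :
  S \subset due_real setT -> o != Balance -> posterior p o S = set0.
Proof.
move=> /subsetP real neq_oB; apply/setP=> y; rewrite inE; apply/posteriorP.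
move=> -[[i f] [/real + oE _]]; rewrite !inE /= => /eqP fE.
by rewrite -oE fE eqxx in neq_oB.
Qed.

Definition same_coin S : Prop := {in S &, forall x y, x.1 = y.1}.

Definition findable w S : Prop :=
  exists s, (forall x, x \in S -> size (outcomes s x.1 x.2) <= w) /\
    {in S &, forall x y, outcomes s x.1 x.2 = outcomes s y.1 y.2 -> x.1 = y.1}.

Lemma can_find_withinP w : can_find_within N w <-> findable w setT.
Proof.
split=> [[s [finds uses]]|[s [sz sep]]]; exists s; split.
- by move=> x _; apply: uses.
- by move=> x y _ _; apply: finds.
- by move=> i j f g; apply: (sep (i, f) (j, g)); rewrite inE.
- by move=> i f; apply: (sz (i, f)); rewrite inE.
Qed.

Lemma findable_subset w S T : S \subset T -> findable w T -> findable w S.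
Proof.
move=> /subsetP sST [s [sz sep]]; exists s.
by split=> [x /sST|x y /sST xT /sST]; [apply: sz | apply: sep].
Qed.

Lemma same_coin_findable w S : same_coin S -> findable w S.
Proof. by move=> sameS; exists Stop; split=> // x y xS yS _; apply: sameS. Qed.

Lemma findable0 S : findable 0 S -> same_coin S.
Proof.
move=> [s [sz sep]] x y xS yS; apply: sep => //.
by move: (sz x xS) (sz y yS); rewrite !leqn0 => /nilP-> /nilP->.
Qed.

Lemma findableS w S :
  findable w.+1 S <->
  same_coin S \/ exists p, forall o, findable w (posterior p o S).
Proof.
split=> [[[|p next] [sz sep]]|[/same_coin_findable //|[p found]]].
- by left=> x y xS yS; apply: sep.
- right; exists p => o; exists (next o); split.
    by move=> _ /posteriorP[x [xS <- ->]]; apply: (sz x xS).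
  move=> _ _ /posteriorP[x [xS wx ->]] /posteriorP[y [yS wy ->]] eq_next.
  by apply: (sep x y xS yS); rewrite /= wx wy; congr (_ :: _).
have [sB [szB sepB]] := found Balance.
have [sL [szL sepL]] := found LeftLighter.
have [sR [szR sepR]] := found RightLighter.
exists (Weigh p (fun o => match o with
  Balance => sB | LeftLighter => sL | RightLighter => sR end)); split=> [x|x y].
  move=> /(mem_posterior p) /=; rewrite ltnS.
  by case: weigh; [apply: szB | apply: szL | apply: szR].
move=> /(mem_posterior p) xo /(mem_posterior p) yo /= [eq_o]; rewrite -eq_o in yo *.
case: weigh xo yo => xo yo; [exact: sepB xo yo | exact: sepL xo yo | exact: sepR xo yo].
Qed.

Lemma same_coin_card_le1 S : same_coin S -> {in S &, injective fst} -> #|S| <= 1.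
Proof.
by move=> sameS injS; apply/card_le1_eqP=> x y xS yS; apply: injS => //; apply: sameS.
Qed.

Lemma card_findable w S : {in S &, injective fst} -> findable w S ->
  #|S| <= jac w.+2 /\ (S \subset due_real setT -> #|S| <= jac w.+1).
Proof.
elim: w S => [|w IH] S injS.
  by move=> /findable0/same_coin_card_le1/(_ injS).
move=> /findableS[/same_coin_card_le1/(_ injS) le1|[p found]].
  by split=> [|_]; apply: leq_trans le1 (jac_gt0 _).
have {}IH o := IH _ (posterior_inj_fst injS) (found o).
rewrite (card_posteriors p); have [le_balance _] := IH Balance.
split=> [|real]; last first.
  rewrite (@posterior_due_real p LeftLighter) // (@posterior_due_real p RightLighter) //.
  by rewrite cards0 !addn0.
have [_ le_left] := IH LeftLighter; have [_ le_right] := IH RightLighter.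
rewrite (jacSS w.+1) mul2n -addnn addnA !leq_add //.
  exact: le_left (subset_trans (posterior_LeftLighter p S) (due_real_subT _)).
exact: le_right (subset_trans (posterior_RightLighter p S) (due_real_subT _)).
Qed.

Lemma can_find_within_leq_jac w : can_find_within N w -> N <= jac w.+1.
Proof.
move=> /can_find_withinP/(findable_subset (subsetT (due_real setT))) found.
have card_real : #|due_real setT| = N by rewrite cardsX cardsT card_ord cards1 muln1.
rewrite -card_real; apply: (card_findable _ found).2 => //.
by move=> [i f] [j g]; rewrite !inE /= => /eqP-> /eqP-> ->.
Qed.

Definition unknown_or_due_fake U F : {set state} := setX U setT :|: setX F [set true].

Lemma posterior_unknown_or_due_fake p U F :
  posterior p Balance (unknown_or_due_fake U F) \subset
  unknown_or_due_fake (U :\: pans p) ((F :\: pans p) :|: (U :&: pans p)).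
Proof.
apply/subsetP=> _ /posteriorP[[i f] [+ + ->]].
rewrite /weigh /step /next_fake /pans !inE /=.
by case: f; case: (i \in U); case: (i \in F);
  case: (i \in left_pan p); case: (i \in right_pan p).
Qed.

Lemma posterior_balance_due_real p A :
  left_pan p = A ->
  posterior p Balance (due_real A) \subset unknown_or_due_fake set0 A.
Proof.
move=> <-; apply/subsetP=> _ /posteriorP[[i f] [+ _ ->]].
by rewrite /step /next_fake !inE /= => /andP[-> /eqP->].
Qed.

Lemma findable_due_realS w A :
  2 * #|A| <= N -> findable w (unknown_or_due_fake set0 A) ->
  findable w.+1 (due_real A).
Proof.
move=> /exists_weighing_left[p leftA] found; apply/findableS; right; exists p.
case; first exact: findable_subset (posterior_balance_due_real leftA) found.
all: by rewrite posterior_due_real ?due_real_subT //;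
  apply: same_coin_findable => x y; rewrite inE.
Qed.

Lemma same_coin_subset A S : #|A| <= 1 -> S \subset setX A setT -> same_coin S.
Proof.
move=> /card_le1_eqP A1 /subsetP sSA [i f] [j g].
by move=> /sSA + /sSA; rewrite !inE !andbT => iA jA; apply: A1.
Qed.

Lemma same_coin_due_real A : #|A| <= 1 -> same_coin (due_real A).
Proof. by move/same_coin_subset; apply; rewrite setXS ?subsetT. Qed.

Lemma same_coin_unknown_or_due_fake U F :
  #|U| + #|F| <= 1 -> same_coin (unknown_or_due_fake U F).
Proof.
move=> /(leq_trans (leq_card_setU U F))/same_coin_subset; apply.
by rewrite subUset !setXS ?subsetUl ?subsetUr ?subsetT.
Qed.

Lemma findable_weigh w p S :
  findable w (posterior p Balance S) -> findable w (due_real (left_pan p)) ->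
  findable w (due_real (right_pan p)) -> findable w.+1 S.
Proof.
move=> foundB foundL foundR; apply/findableS; right; exists p; case=> //.
  exact: findable_subset (posterior_LeftLighter p S) foundL.
exact: findable_subset (posterior_RightLighter p S) foundR.
Qed.

End States.

(* Given [u] unknown coins and [f] coins due to act fake, weigh [a] of the former
   and [b] of the latter, [k] on each pan. *)
Lemma exists_weighing_sizes (w u f : nat) :
  u <= jac w.+2 -> 2 * u + f <= jac w.+3 + (0 < u) ->
  exists a b k, [/\ a <= u, b <= f, a + b = 2 * k, k <= jac w.+1 &
    u - a <= jac w.+1 /\ 2 * (u - a) + (f - b + a) <= jac w.+2 + (0 < u - a)].
Proof.
rewrite (jacSS w.+1).
have : jac w.+2 <= (2 * jac w.+1).+1 by have := jacS w.+1; lia.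
move: (jac_gt0 w) (jac_gt0 w.+1); move: (jac w.+1) (jac w.+2) => J J' J_gt0 J'_gt0.
move=> le_JJ' le_u le_uf; have [many|few] := ltnP (2 * J) (u + f).
  by exists u.-1, (2 * J - u.-1), J; case: u le_u le_uf many => [|u] /=; split; lia.
have [k] : exists k, u + f = 2 * k \/ u + f = (2 * k).+1.
  by exists (u + f)./2; lia.
case=> def_uf; first by exists u, f, k; split; lia.
by exists u.-1, (2 * k - u.-1), k; case: u le_u le_uf few def_uf => [|u] /=; split; lia.
Qed.

Lemma findable_leq_jac (N w : nat) :
  (forall U F : {set 'I_N}, [disjoint U & F] -> #|U| <= jac w.+1 ->
     2 * #|U| + #|F| <= jac w.+2 + (0 < #|U|) ->
     findable w (unknown_or_due_fake U F)) /\
  (forall A : {set 'I_N}, 2 * #|A| <= N -> #|A| <= jac w.+1 ->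
     findable w (due_real A)).
Proof.
elim: w => [|w [IHfake IHreal]].
  split=> [U F _ leU leUF|A _ leA]; apply: same_coin_findable.
    apply: same_coin_unknown_or_due_fake.
    by move: leU leUF; rewrite -[jac 1]/1 -[jac 2]/1; lia.
  exact: same_coin_due_real.
split=> [U F disUF leU leUF|A leAN leA]; last first.
  apply: findable_due_realS => //; apply: IHfake; rewrite ?cards0 ?addn0 //.
  by rewrite disjoints_subset sub0set.
have [a [b [k [leaU lebF eq_abk lek [leU' leUF']]]]] := exists_weighing_sizes leU leUF.
have [p [cardL cardU cardF]] := exists_weighing_cards disUF leaU lebF eq_abk.
have le_pansN : 2 * k <= N by rewrite -cardL -card_pans -[N in _ <= N]card_ord max_card.
apply: (@findable_weigh _ _ p); last 2 first.
- by apply: IHreal; rewrite cardL.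
- by apply: IHreal; rewrite -pans_same_size cardL.
apply: findable_subset (posterior_unknown_or_due_fake p U F) _.
have cardU' : #|U :\: pans p| = #|U| - a by rewrite cardsD cardU.
apply: IHfake; rewrite ?cardU' //.
  apply/pred0P=> i /=; rewrite !inE.
  by have := disjointFr disUF (x := i); case: (i \in U) => [->|] //; case: (_ || _).
apply: leq_trans leUF'; rewrite leq_add2l -cardU -cardF -cardsD.
exact: leq_card_setU.
Qed.

Lemma leq_jac_can_find_within (N w : nat) : N <= jac w.+1 -> can_find_within N w.
Proof.
move=> leN; apply/can_find_withinP; have [found _] := findable_leq_jac N w.
have all_unknown : setT \subset @unknown_or_due_fake N setT set0.
  by apply/subsetP=> x; rewrite !inE.
apply: findable_subset all_unknown (found _ _ _ _ _).
- by rewrite disjoint_sym disjoints_subset sub0set.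
- by rewrite cardsT card_ord.
- by rewrite cardsT card_ord cards0; have := jacS w.+1; lia.
Qed.

Theorem mainTheorem6 (w N : nat) (hw : (1 <= w)%N)
  (hlo : (jacobsthal w < N%:R)%R) (hhi : (N%:R <= jacobsthal w.+1)%R) :
  is_a N w.
Proof.
rewrite jacobsthalE Num.Theory.ltr_nat in hlo.
rewrite jacobsthalE Num.Theory.ler_nat in hhi.
split=> [|v /can_find_within_leq_jac leN]; first exact: leq_jac_can_find_within.
rewrite leqNgt; apply: contraL (leq_trans hlo leN) => lt_vw.
by rewrite -leqNgt leq_jac.
Qed.
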